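(* For any integers $p\ge 2$ and $q\in\{0,1,2\}$ with $(p,q)\neq(2,0)$, there is a triangle-free $2$-self-centered graph $G=GCB_X(k,\ell,\mathbb{A}_r,\mathbb{B}_s)$ (for some non-negative integers $k,\ell,r,s$ and some graph $X$ having an SBIC via $(\mathbb{A}_r,\mathbb{B}_s)$) such that $\chi(X)=p$ and $\chi(G)=\chi(X)+q$.
   Context: All graphs are finite and simple; $\chi(H)$ is the chromatic number of $H$. A graph is $2$-self-centered if its diameter and its radius (maximum and minimum eccentricity) are both $2$. $u\sim v$ means $u$ and $v$ are adjacent. $d_X(u,v)$ is the distance in $X$ ($\infty$ if there is no path), and $d_X(u,S)=\min\{d_X(u,v): v\in S\}$ for $S\subseteq V(X)$ ($\infty$ if $S=\emptyset$). The graph $X$ below may have empty vertex set. Equality $G=GCB_X(\dots)$ is understood up to isomorphism. **SBIC.** A graph $X$ has a specialized bi-independent covering via $(\mathbb{A}_r,\mathbb{B}_s)$ (an SBIC via $(\mathbb{A}_r,\mathbb{B}_s)$) if: (i) $X$ is triangle-free. (ii) $\mathbb{A}_r=\{A_1,\dots,A_r\}$ and $\mathbb{B}_s=\{B_1,\dots,B_s\}$ are two (indexed) families of not necessarily distinct independent sets of $X$ such that $V(X)=\bigcup_{i=1}^r A_i=\bigcup_{j=1}^s B_j$. (iii) For all $u,v\in V(X)$, if $d_X(u,v)\ge 3$, then there is $1\le i\le r$ with $u,v\in A_i$ or there is $1\le j\le s$ with $u,v\in B_j$. (iv) For all $u\in V(X)$ and $i\in\{1,\dots,r\}$, if $d_X(u,A_i)\ge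 2$, then there is $j\in\{1,\dots,s\}$ such that $A_i\cap B_j=\emptyset$ and $u\in B_j$. (v) For all $u\in V(X)$ and $j\in\{1,\dots,s\}$, if $d_X(u,B_j)\ge 2$, then there is $i\in\{1,\dots,r\}$ such that $A_i\cap B_j=\emptyset$ and $u\in A_i$. **$X$-generalized complete bipartite graph.** A graph $G$ is $X$-generalized complete bipartite, denoted $GCB_X(k,\ell,\mathbb{A}_r,\mathbb{B}_s)$ with $k,\ell,r,s\ge 0$, if $X$ has an SBIC via $(\mathbb{A}_r,\mathbb{B}_s)$ and $G$ is constructed as follows (the only edges of $G$ are those listed in (1)--(6)): (1) $V(G)=K\cup L\cup Y\cup Z\cup V(X)$ (disjoint union), where $|K|=k$, $|L|=\ell$, $Y=\{y_1,\dots,y_r\}$ with $|Y|=r$, $Z=\{z_1,\dots,z_s\}$ with $|Z|=s$; moreover $E(X)\subseteq E(G)$. (2) $a\sim t$ for all $a\in K$ and $t\in L\cup Y$. (3) $b\sim t$ for all $b\in L$ and $t\in K\cup Z$. (4) $y_i\sim t$ for all $t\in A_i$ and $1\le i\le r$. (5) $z_j\sim t$ for all $t\in B_j$ and $1\le j\le s$. (6) $y_i\sim z_j$ if and only if $A_i\cap B_j=\emptyset$. In addition the following conditions are required: (7) If $k=0$ and $\ell\ne 0$, then every member of $Y$ has a neighbor in $Z$; moreover, for all $i\ne j$ in $\{1,\dots,r\}$, we have $A_i\cap A_j\ne\emptyset$ or there is $p\in\{1,\dots,s\}$ such that $A_i\cap B_p=A_j\cap B_p=\emptyset$. (8) If $k\ne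 0$ and $\ell=0$, then every member of $Z$ has a neighbor in $Y$; moreover, for all $i\ne j$ in $\{1,\dots,s\}$, we have $B_i\cap B_j\ne\emptyset$ or there is $q\in\{1,\dots,r\}$ such that $B_i\cap A_q=B_j\cap A_q=\emptyset$. (9) If $k=\ell=0$, then $r,s\ge 1$; for all $i\ne j$ in $\{1,\dots,r\}$, we have $A_i\cap A_j\neq\emptyset$ or there is $p\in\{1,\dots,s\}$ such that $A_i\cap B_p=A_j\cap B_p=\emptyset$; and for all $i\ne j$ in $\{1,\dots,s\}$, we have $B_i\cap B_j\neq\emptyset$ or there is $q\in\{1,\dots,r\}$ such that $B_i\cap A_q=B_j\cap A_q=\emptyset$. (10) $r=s=0$ if and only if $V(X)=\emptyset$ and $k,\ell\ge 2$. (11) If $|V(X)|=1$, then $k$ and $\ell$ are non-zero. Convention: either $r=s=0$ and $V(X)=\emptyset$, or $r,s\ge 1$ and $V(X)\ne\emptyset$. (The indices $p,q$ inside (7)--(9) are local and unrelated to the integers $p,q$ of the claim.) *)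

(* Defs.v *)
From HB Require Import structures.
From mathcomp Require Import all_boot.

Set Implicit Arguments.
Unset Strict Implicit.
Unset Printing Implicit Defensive.

Record sgraph := SGraph {
  svertex :> finType;
  sedge : rel svertex;
  sedge_sym : symmetric sedge;
  sedge_irrefl : irreflexive sedge
}.

Notation "x -- y" := (sedge x y) (at level 30, no associativity).

(* Natural numbers extended with infinity, represented by [None]. *)
Definition enat := option nat.

Definition emin (x y : enat) : enat :=
  match x, y with
  | Some m, Some n => Some (minn m n)
  | Some _, None => x
  | None, _ => y
  end.

Definition emax (x y : enat) : enat :=
  match x, y with
  | Some m, Some n => Some (maxn m n)
  | _, _ => None
  end.

Lemma eminA : associative emin.
Proof. by case=> [m|] [n|] [p|] //=; rewrite minnA. Qed.

Lemma eminC : commutative emin.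
Proof. by case=> [m|] [n|] //=; rewrite minnC. Qed.

Lemma emin0x : left_id None emin.
Proof. by case. Qed.

HB.instance Definition _ :=
  Monoid.isComLaw.Build enat None emin eminA eminC emin0x.

Lemma emaxA : associative emax.
Proof. by case=> [m|] [n|] [p|] //=; rewrite maxnA. Qed.

Lemma emaxC : commutative emax.
Proof. by case=> [m|] [n|] //=; rewrite maxnC. Qed.

Lemma emax0x : left_id (Some 0) emax.
Proof. by case=> //= n; rewrite max0n. Qed.

HB.instance Definition _ :=
  Monoid.isComLaw.Build enat (Some 0) emax emaxA emaxC emax0x.

Definition ele (x y : enat) : bool :=
  match x, y with
  | Some m, Some n => m <= n
  | _, None => true
  | None, Some _ => false
  end.

Section Graphs.
Variable G : sgraph.
Implicit Types (u v : G) (S : {set G}).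

Definition triangle_free : Prop :=
  forall u v w, ~~ [&& u -- v, v -- w & u -- w].

Definition independent S : Prop := {in S &, forall u v, ~~ u -- v}.

Definition colorable (c : nat) : bool :=
  [exists f : {ffun G -> 'I_c}, forall u, forall v, u -- v ==> (f u != f v)].

Lemma colorable_exists : exists c, colorable c.
Proof.
exists #|G|; apply/existsP; exists [ffun u => enum_rank u].
apply/forallP => u; apply/forallP => v; apply/implyP => uv.
rewrite !ffunE; apply/eqP => /enum_rank_inj euv.
by move: uv; rewrite euv sedge_irrefl.
Qed.

Definition chromatic_number : nat := ex_minn colorable_exists.

Definition walk (n : nat) u v : bool :=
  [exists t : n.-tuple G, path (@sedge G) u t && (last u t == v)].

(* A shortest walk between two vertices is a path, so its length is smaller
   than the number of vertices; see [ele_dist]. *)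
Definition dist u v : enat :=
  \big[emin/None]_(n < #|G| | walk n u v) Some (val n).

Definition dist_set u S : enat := \big[emin/None]_(v in S) dist u v.

Definition eccentricity u : enat := \big[emax/Some 0]_(v : G) dist u v.

Definition diameter : enat := \big[emax/Some 0]_(u : G) eccentricity u.

Definition radius : enat := \big[emin/None]_(u : G) eccentricity u.

Definition two_self_centered : Prop := diameter = Some 2 /\ radius = Some 2.

Lemma ele_dist m u v :
  ele (dist u v) (Some m) <-> exists2 n, n <= m & walk n u v.
Proof.
have ele_emin x y :
  ele (emin x y) (Some m) = ele x (Some m) || ele y (Some m).
  by case: x y => [a|] [b|] //=; rewrite ?orbF // geq_min.
rewrite /dist (big_morph (fun x => ele x (Some m)) ele_emin (erefl : ele None (Some m) = false)).
rewrite big_has_cond /=; split.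
  by move=> /hasP[n _ /andP[wn le_nm]]; exists n.
case=> n le_nm /existsP[t /andP[ep /eqP <-]].
have lastp_def := erefl (last u t); case/shortenP: {2 3}_ / ep lastp_def.
move=> p' ep' up' sub elast.
have szp : size p' < #|G| by rewrite -[_.+1]/(size (u :: p')) -(card_uniqP up') max_card.
have szle : size p' <= m.
  apply: leq_trans le_nm; rewrite -(size_tuple t).
  by apply: uniq_leq_size => //; case/andP: up'.
apply/hasP; exists (Ordinal szp); first by rewrite mem_index_enum.
rewrite /= szle andbT; apply/existsP; exists (in_tuple p').
by rewrite /= ep' elast eqxx.
Qed.

End Graphs.

Definition sgraph_iso (G H : sgraph) : Prop :=
  exists2 f : G -> H, bijective f & forall u v, (f u) -- (f v) = u -- v.

Record SBIC (X : sgraph) (r s : nat)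
    (A : 'I_r -> {set X}) (B : 'I_s -> {set X}) : Prop := {
  SBIC_triangle_free : triangle_free X;
  SBIC_indepA : forall i, independent (A i);
  SBIC_indepB : forall j, independent (B j);
  SBIC_coverA : \bigcup_i A i = [set: X];
  SBIC_coverB : \bigcup_j B j = [set: X];
  SBIC_far : forall u v : X, ele (Some 3) (dist u v) ->
    (exists i, u \in A i /\ v \in A i) \/ (exists j, u \in B j /\ v \in B j);
  SBIC_farA : forall (u : X) i, ele (Some 2) (dist_set u (A i)) ->
    exists j, A i :&: B j = set0 /\ u \in B j;
  SBIC_farB : forall (u : X) j, ele (Some 2) (dist_set u (B j)) ->
    exists i, A i :&: B j = set0 /\ u \in A i
}.

Inductive gcb_vertex (X : finType) (k l r s : nat) : Type :=
  | VK of 'I_k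
  | VL of 'I_l
  | VY of 'I_r
  | VZ of 'I_s
  | VX of X.

Arguments VK {X k l r s}.
Arguments VL {X k l r s}.
Arguments VY {X k l r s}.
Arguments VZ {X k l r s}.
Arguments VX {X k l r s}.

Section GCBVertexFinite.
Variables (X : finType) (k l r s : nat).

Definition gcb_vertex_encode (u : gcb_vertex X k l r s) :
    'I_k + 'I_l + 'I_r + 'I_s + X :=
  match u with
  | VK a => inl (inl (inl (inl a)))
  | VL b => inl (inl (inl (inr b)))
  | VY i => inl (inl (inr i))
  | VZ j => inl (inr j)
  | VX x => inr x
  end.

Definition gcb_vertex_decode (c : 'I_k + 'I_l + 'I_r + 'I_s + X) :
    gcb_vertex X k l r s :=
  match c with
  | inl (inl (inl (inl a))) => VK a
  | inl (inl (inl (inr b))) => VL b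
  | inl (inl (inr i)) => VY i
  | inl (inr j) => VZ j
  | inr x => VX x
  end.

Lemma gcb_vertex_encodeK : cancel gcb_vertex_encode gcb_vertex_decode.
Proof. by case. Qed.

HB.instance Definition _ :=
  Finite.copy (gcb_vertex X k l r s) (can_type gcb_vertex_encodeK).

End GCBVertexFinite.

Section GCB.
Variables (X : sgraph) (k l r s : nat).
Variables (A : 'I_r -> {set X}) (B : 'I_s -> {set X}).

Definition gcb_edge (u v : gcb_vertex X k l r s) : bool :=
  match u, v with
  | VX x, VX y => x -- y
  | VK _, VL _ | VL _, VK _ => true
  | VK _, VY _ | VY _, VK _ => true
  | VL _, VZ _ | VZ _, VL _ => true
  | VY i, VX x | VX x, VY i => x \in A i
  | VZ j, VX x | VX x, VZ j => x \in B j
  | VY i, VZ j | VZ j, VY i => A i :&: B j == set0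
  | _, _ => false
  end.

Lemma gcb_edge_sym : symmetric gcb_edge.
Proof. by case=> [a|a|a|a|a] [b|b|b|b|b] //=; apply: sedge_sym. Qed.

Lemma gcb_edge_irrefl : irreflexive gcb_edge.
Proof. by case=> [a|a|a|a|a] //=; apply: sedge_irrefl. Qed.

Definition gcb_graph : sgraph := SGraph gcb_edge_sym gcb_edge_irrefl.

Definition Y_has_nbr_in_Z : Prop :=
  forall i, exists j, @sedge gcb_graph (VY i) (VZ j).

Definition Z_has_nbr_in_Y : Prop :=
  forall j, exists i, @sedge gcb_graph (VZ j) (VY i).

Definition A_pairs : Prop := forall i j, i != j ->
  A i :&: A j <> set0 \/ exists p, A i :&: B p = set0 /\ A j :&: B p = set0.

Definition B_pairs : Prop := forall i j, i != j ->
  B i :&: B j <> set0 \/ exists q, B i :&: A q = set0 /\ B j :&: A q = set0.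

Record gcb_conditions : Prop := {
  gcb_K0 : k = 0 -> l <> 0 -> Y_has_nbr_in_Z /\ A_pairs;
  gcb_L0 : k <> 0 -> l = 0 -> Z_has_nbr_in_Y /\ B_pairs;
  gcb_KL0 : k = 0 -> l = 0 -> [/\ 1 <= r, 1 <= s, A_pairs & B_pairs];
  gcb_rs0 : (r = 0 /\ s = 0) <-> [/\ #|X| = 0, 2 <= k & 2 <= l];
  gcb_X1 : #|X| = 1 -> k <> 0 /\ l <> 0;
  gcb_convention :
    [/\ r = 0, s = 0 & #|X| = 0] \/ [/\ 1 <= r, 1 <= s & #|X| <> 0]
}.

Definition is_GCB (G : sgraph) : Prop :=
  [/\ SBIC A B, gcb_conditions & sgraph_iso G gcb_graph].

End GCB.

(* Main.v *)
Require Import Defs.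
From mathcomp Require Import all_boot.

(** Take [k = l = 1].  Let [X] consist of [2p] disjoint copies of a
triangle-free graph of chromatic number [p], together with an isolated vertex
[v0].  Every colouring uses at least [p] colours on each copy, so a greedy
choice of one vertex in each of [p] copies gives an independent set carrying
[p] distinct colours; doing it twice gives disjoint such sets [S] and [T] with
[S :|: T] independent.

- [q = 2]: both families consist of all independent sets.  With [p + 1] colours,
  the vertices of [Y] attached to [S] and to [S :|: T] would have the same
  colour, and so would the vertex of [Y] attached to [S :|: T] and the vertex of
  [Z] attached to [T]; but [S] and [T] are disjoint, so the vertices attached to
  them are adjacent.
- [q = 1]: fix a [p]-colouring [f] of [X], let the first family consist of the
  independent sets that miss some colour of [f] and the second one of all
  independent sets.  The vertices of [Y] reuse a missing colour, and a single
  new colour suffices for [Z] and [K]; the vertex of [Z] attached to [S] forces it.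
- [q = 0]: fix a [p]-colouring of [X] and colours [c0, c1, c2] with [c0] the
  colour of [v0].  The vertices of [Y] attached to sets missing [c0] and those
  of [Z] attached to sets missing [c1] get these colours.  All other sets
  contain [v0] and miss [c2], so their vertices can share [c2], since no two of
  these sets are disjoint.  Domination requirements make the covering
  conditions hold.

The case [q = 1], iterated from [K_2], also provides triangle-free graphs of
every chromatic number. *)

Set Implicit Arguments.
Unset Strict Implicit.
Unset Printing Implicit Defensive.

(** * Distances *)

Lemma eleS m (d : enat) : ele (Some m.+1) d = ~~ ele d (Some m).
Proof. by case: d => //= n; rewrite ltnNge. Qed.

Section Distance.
Variable G : sgraph.
Implicit Types (u v w : G) (S : {set G}).

Lemma walk0 u v : walk 0 u v = (u == v).
Proof.
apply/existsP/eqP => [[t]|->]; last by exists [tuple]; rewrite /= eqxx.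
by rewrite (tuple0 t) /= => /eqP.
Qed.

Lemma walkS n u v : walk n.+1 u v = [exists w, (u -- w) && walk n w v].
Proof.
apply/existsP/existsP => [[t]|[w /andP[uw /existsP[t /andP[pt lt]]]]].
  case/tupleP: t => w t /= /andP[/andP[uw pt] lt].
  by exists w; rewrite uw; apply/existsP; exists t; rewrite pt.
by exists [tuple of w :: t]; rewrite /= uw pt.
Qed.

Lemma dist_le1 u v : ele (dist u v) (Some 1) = (u == v) || u -- v.
Proof.
apply/idP/idP => [/ele_dist[[|[|//]] _]|/orP[uv|uv]]; last 2 first.
- by apply/ele_dist; exists 0; rewrite ?walk0.
- apply/ele_dist; exists 1 => //; rewrite walkS.
  by apply/existsP; exists v; rewrite uv walk0 eqxx.
- by rewrite walk0 => ->.
by rewrite walkS => /existsP[w]; rewrite walk0 => /andP[uw /eqP <-]; rewrite uw orbT.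
Qed.

Lemma dist_le2 u v :
  ele (dist u v) (Some 2) =
    [|| u == v, u -- v | [exists w, (u -- w) && (w -- v)]].
Proof.
apply/idP/idP => [/ele_dist[[|[|[|//]]] _]|].
- by rewrite walk0 => ->.
- rewrite walkS => /existsP[w]; rewrite walk0 => /andP[uw /eqP <-].
  by rewrite uw orbT.
- rewrite walkS => /existsP[w /andP[uw]].
  rewrite walkS => /existsP[w']; rewrite walk0 => /andP[ww' /eqP <-].
  by apply/or3P/Or33; apply/existsP; exists w; rewrite uw.
case/or3P => [uv|uv|/existsP[w /andP[uw wv]]]; apply/ele_dist.
- by exists 0; rewrite ?walk0.
- exists 1 => //; rewrite walkS.
  by apply/existsP; exists v; rewrite uv walk0 eqxx.
exists 2 => //; rewrite walkS; apply/existsP; exists w; rewrite uw walkS.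
by apply/existsP; exists v; rewrite wv walk0 eqxx.
Qed.

Lemma dist_set_ge m u S :
  ele (Some m) (dist_set u S) <-> {in S, forall v, ele (Some m) (dist u v)}.
Proof.
have ele_emin x y :
    ele (Some m) (emin x y) = ele (Some m) x && ele (Some m) y.
  by case: x y => [a|] [b|] //=; rewrite ?andbT // leq_min.
rewrite /dist_set (big_morph (ele (Some m)) ele_emin (erefl _)) big_all_cond.
split=> [/allP + v vS|all_ge].
  by move=> /(_ v (mem_index_enum v))/implyP; apply.
by apply/allP => v _; apply/implyP => /all_ge.
Qed.

Lemma dist_set_ge2 u S :
  ele (Some 2) (dist_set u S) <-> u \notin S /\ {in S, forall v, ~~ u -- v}.
Proof.
split=> [/dist_set_ge ge2|[uS nuS]]; last apply/dist_set_ge => v vS.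
  split=> [|v vS]; last first.
    by have := ge2 v vS; rewrite eleS dist_le1 negb_or => /andP[].
  by apply/negP => uS; have := ge2 u uS; rewrite eleS dist_le1 eqxx.
rewrite eleS dist_le1 negb_or nuS // andbT.
by apply: contraNneq uS => ->.
Qed.

(** The two conditions force every eccentricity to be exactly 2. The vertex [u0] rules out the empty
    graph, whose diameter is [Some 0] and whose radius is [None]. *)
Lemma two_self_centeredP (u0 : G) :
  (forall u v, ele (dist u v) (Some 2)) ->
  (forall u, exists v, ~~ ((u == v) || u -- v)) -> two_self_centered G.
Proof.
move=> le2 ge2.
have emax_ele2 (F : G -> enat) v : (forall u, ele (F u) (Some 2)) ->
    F v = Some 2 -> \big[emax/Some 0]_u F u = Some 2.
  move=> leF Fv; rewrite (bigD1 v) //= Fv.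
  have: ele (\big[emax/Some 0]_(i | i != v) F i) (Some 2).
    elim/big_ind: _ => [//|x y|u _]; last exact: leF.
    by case: x y => [a|] [b|] //= ha hb; rewrite geq_max ha.
  by case: (\big[emax/_]_(i | _) _) => //= n /maxn_idPl ->.
have ecc2 u : eccentricity u = Some 2.
  have [v uv] := ge2 u; apply: (emax_ele2 _ v) => //.
  move: uv (le2 u v); rewrite -dist_le1 -eleS; case: (dist u v) => //= n.
  by move=> ge le; congr Some; apply/eqP; rewrite eqn_leq le.
split; first by apply: (emax_ele2 _ u0) => [u|]; rewrite ecc2.
rewrite /radius (eq_bigr (fun=> Some 2)) //.
rewrite (bigD1 u0) // big_const.
by elim: #|_| => // n IHn; rewrite iterS IHn.
Qed.

End Distance.

(** * Colourings *)

Definition proper_coloring (G : sgraph) (C : eqType) (f : G -> C) : Prop :=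
  forall u v, u -- v -> f u != f v.

Lemma chromatic_coloring (G : sgraph) :
  exists f : G -> 'I_(chromatic_number G), proper_coloring f.
Proof.
rewrite /chromatic_number; case: ex_minnP => c /existsP[f /forallP fP] _.
by exists f => u v; move/forallP: (fP u) => /(_ v)/implyP.
Qed.

(** Counting only the colours in use yields a lower bound for each copy of [G] inside a larger
    coloured graph. *)
Lemma chromatic_le_codom (G : sgraph) (C : finType) (f : G -> C) :
  proper_coloring f -> chromatic_number G <= #|codom f|.
Proof.
move=> fP; rewrite /chromatic_number; case: ex_minnP => c _; apply.
apply/existsP; exists [ffun u => enum_rank_in (codom_f f u) (f u)].
apply/forallP => u; apply/forallP => v; apply/implyP => uv; rewrite !ffunE.
apply: contra (fP u v uv) => /eqP/(congr1 enum_val).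
by rewrite !enum_rankK_in ?codom_f // => ->.
Qed.

Lemma chromatic_le (G : sgraph) (C : finType) (f : G -> C) :
  proper_coloring f -> chromatic_number G <= #|C|.
Proof. by move=> fP; apply: leq_trans (chromatic_le_codom fP) (max_card _). Qed.

Lemma chromatic_le_hom (G H : sgraph) (h : G -> H) :
  (forall u v, u -- v -> (h u) -- (h v)) ->
  chromatic_number G <= chromatic_number H.
Proof.
move=> hE; have [f fP] := chromatic_coloring H.
by rewrite -[leqRHS]card_ord; apply: (@chromatic_le _ _ (f \o h)) => u v /hE/fP.
Qed.

(** Greedy choice: the tail of [s] uses fewer values than [h j] takes, so a fresh value remains for
    the head [j]. *)
Lemma rainbow_section (J : eqType) (T C : finType) (x0 : T)
    (h : J -> T -> C) (s : seq J) :
  uniq s -> (forall j, size s <= #|codom (h j)|) ->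
  exists t : J -> T, uniq [seq h j (t j) | j <- s].
Proof.
elim: s => [_ _|j s IHs /= /andP[js us] le_s]; first by exists (fun=> x0).
have [t ut] := IHs us (fun j => ltnW (le_s j)).
have [/existsP[x hx]|/existsPn all_in] :=
    boolP [exists x, h j x \notin [seq h j (t j) | j <- s]].
  exists (fun i => if i == j then x else t i) => /=; rewrite eqxx.
  have -> : [seq h i (if i == j then x else t i) | i <- s]
              = [seq h i (t i) | i <- s].
    by apply/eq_in_map => i si; case: eqP js => // <-; rewrite si.
  by rewrite hx.
have: #|codom (h j)| <= #|[seq h j (t j) | j <- s]|.
  apply/subset_leq_card/subsetP => _ /codomP[x ->].
  by have := all_in x; rewrite negbK.
move/(leq_trans (le_s j)) => lt_s.
by have := leq_trans lt_s (card_size _); rewrite size_map ltnn.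
Qed.

(** * Generalized complete bipartite graphs *)

Section GCBTheory.
Variables (X : sgraph) (k l r s : nat).
Variables (A : 'I_r -> {set X}) (B : 'I_s -> {set X}).
Hypothesis AB : SBIC A B.

(** Vertices of [K] and [L] lie in no triangle, and [Y] and [Z] are independent. The remaining types
    XXX, XXY, XXZ and XYZ are each excluded by one of the four facts below. *)
Lemma gcb_triangle_free : triangle_free (gcb_graph k l A B).
Proof.
have AX i x y : x \in A i -> y \in A i -> x -- y -> False.
  by move=> xA yA; apply/negP; apply: (SBIC_indepA AB xA yA).
have BX j x y : x \in B j -> y \in B j -> x -- y -> False.
  by move=> xB yB; apply/negP; apply: (SBIC_indepB AB xB yB).
have ABX i j x : x \in A i -> x \in B j -> A i :&: B j == set0 -> False.
  by move=> xA xB /eqP/setP/(_ x); rewrite !inE xA xB.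
have XXX (x y z : X) : x -- y -> y -- z -> x -- z -> False.
  by move=> xy yz xz; have /negP := SBIC_triangle_free AB x y z; rewrite xy yz xz; apply.
move=> u v w; apply/negP.
by case: u => [a|a|a|a|a]; case: v => [b|b|b|b|b]; case: w => [c|c|c|c|c];
  case/and3P=> //=; eauto.
Qed.

Hypotheses (k_gt0 : 0 < k) (l_gt0 : 0 < l) (x0 : X).

Lemma gcb_two_self_centered : two_self_centered (gcb_graph k l A B).
Proof.
have coverA x : exists i, x \in A i.
  have /bigcupP[i _ xA] : x \in \bigcup_i A i by rewrite (SBIC_coverA AB) inE.
  by exists i.
have coverB x : exists j, x \in B j.
  have /bigcupP[j _ xB] : x \in \bigcup_j B j by rewrite (SBIC_coverB AB) inE.
  by exists j.
have [[i0 _] [j0 _]] := (coverA x0, coverB x0).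
pose a0 := Ordinal k_gt0; pose b0 := Ordinal l_gt0.
(* Subgoals come in reverse order: first a distinct non-neighbour for each kind of vertex, from [X]
   back to [K], then the upper bound 2 on distances. *)
apply: (@two_self_centeredP (gcb_graph k l A B) (VX x0)) => [|[a|b|i|j|x]]; last first.
- by exists (VK a0).
- by exists (VK a0).
- by exists (VL b0).
- by exists (VY i0).
- by exists (VZ j0).
pose near (u v : gcb_graph k l A B) := 
  [|| u == v, u -- v | [exists w, (u -- w) && (w -- v)]].
have near_sym u v : near u v -> near v u.
  case/or3P => [/eqP->|uv|/existsP[w uwv]]; apply/or3P.
  - exact: Or31.
  - by apply: Or32; rewrite sedge_sym.
  - by apply: Or33; apply/existsP; exists w; rewrite sedge_sym andbC sedge_sym.
have via w u v : u -- w -> w -- v -> near u v.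
  by move=> uw wv; apply/or3P/Or33; apply/existsP; exists w; rewrite uw.
have adj u v : u -- v -> near u v by move=> uv; apply/or3P/Or32.
have nearYZ i j : near (VY i) (VZ j).
  have [ABij|/set0Pn[x /setIP[xA xB]]] := eqVneq (A i :&: B j) set0.
    by apply: adj; apply/eqP.
  exact: (via (VX x)).
have nearYX i x : near (VY i) (VX x).
  have [xA|xA] := boolP (x \in A i); first exact: adj.
  have [/exists_inP[y yA xy]|/exists_inPn nxy] :=
      boolP [exists y in A i, x -- y].
    by apply: (via (VX y)) => //=; rewrite sedge_sym.
  have /(SBIC_farA AB)[j [ABij xB]] : ele (Some 2) (dist_set x (A i)).
    by apply/dist_set_ge2.
  by apply: (via (VZ j)) => //=; apply/eqP.
have nearZX j x : near (VZ j) (VX x).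
  have [xB|xB] := boolP (x \in B j); first exact: adj.
  have [/exists_inP[y yB xy]|/exists_inPn nxy] :=
      boolP [exists y in B j, x -- y].
    by apply: (via (VX y)) => //=; rewrite sedge_sym.
  have /(SBIC_farB AB)[i [ABij xA]] : ele (Some 2) (dist_set x (B j)).
    by apply/dist_set_ge2.
  by apply: (via (VY i)) => //=; apply/eqP.
have nearXX x y : near (VX x) (VX y).
  have [|] := boolP (ele (dist x y) (Some 2)).
    rewrite dist_le2 => /or3P[/eqP->|xy|/existsP[z /andP[xz zy]]].
    - by rewrite /near eqxx.
    - exact: adj.
    - exact: (via (VX z)).
  rewrite -eleS => /(SBIC_far AB)[[i [xA yA]]|[j [xB yB]]].
    exact: (via (VY i)).
  exact: (via (VZ j)).
have nearKX a x : near (VK a) (VX x).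
  by have [i xA] := coverA x; apply: (via (VY i)).
have nearLX b x : near (VL b) (VX x).
  by have [j xB] := coverB x; apply: (via (VZ j)).
have nearKK a a' : near (VK a) (VK a') by apply: (via (VL b0)).
have nearLL b b' : near (VL b) (VL b') by apply: (via (VK a0)).
have nearYY i i' : near (VY i) (VY i') by apply: (via (VK a0)).
have nearZZ j j' : near (VZ j) (VZ j') by apply: (via (VL b0)).
have nearKZ a j : near (VK a) (VZ j) by apply: (via (VL b0)).
have nearLY b i : near (VL b) (VY i) by apply: (via (VK a0)).
move=> u v; rewrite dist_le2 -/(near u v).
by case: u => [a|a|a|a|a]; case: v => [b|b|b|b|b] //;
  first [exact: adj | apply: near_sym].
Qed.

(** Positive [k] and [l] make the conditions on empty [K] or [L] vacuous; covering the vertex [x0]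
    forces [r] and [s] to be positive. *)
Lemma gcb_conditions_pos : gcb_conditions k l A B.
Proof.
have r_gt0 : 0 < r.
  have /bigcupP[i _ _] : x0 \in \bigcup_i A i by rewrite (SBIC_coverA AB) inE.
  exact: leq_ltn_trans (ltn_ord i).
have s_gt0 : 0 < s.
  have /bigcupP[j _ _] : x0 \in \bigcup_j B j by rewrite (SBIC_coverB AB) inE.
  exact: leq_ltn_trans (ltn_ord j).
have X_gt0 : 0 < #|X| by apply/card_gt0P; exists x0.
split; try by move: k_gt0 l_gt0; case: (k) (l) => [|?] [|?].
  by split=> [[r0]|[X0]]; [move: r_gt0; rewrite r0|move: X_gt0; rewrite X0].
by right; split=> // X0; move: X_gt0; rewrite X0.
Qed.

End GCBTheory.

(** An index-free form of the covering conditions, with distances replaced by adjacency. The field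
    [bicov_pair] is stronger than required: it concerns all non-adjacent pairs, not just those at
    distance at least 3. *)
Record bicovering (X : sgraph) (P Q : {set {set X}}) : Prop := {
  bicov_indepP : {in P, forall S, independent S};
  bicov_indepQ : {in Q, forall S, independent S};
  bicov_coverP : forall u, exists2 S, S \in P & u \in S;
  bicov_coverQ : forall u, exists2 S, S \in Q & u \in S;
  bicov_pair : forall u v, ~~ u -- v ->
    (exists2 S, S \in P & (u \in S) && (v \in S)) \/
    (exists2 S, S \in Q & (u \in S) && (v \in S));
  bicov_farP : forall u S, S \in P -> u \notin S ->
    {in S, forall v, ~~ u -- v} ->
    exists2 T, T \in Q & (u \in T) && [disjoint S & T];
  bicov_farQ : forall u T, T \in Q -> u \notin T ->
    {in T, forall v, ~~ u -- v} ->
    exists2 S, S \in P & (u \in S) && [disjoint S & T]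
}.

Definition family (T : finType) (P : {set {set T}}) (i : 'I_#|P|) : {set T} :=
  enum_val i.

Lemma familyP (T : finType) (P : {set {set T}}) S :
  S \in P -> exists i : 'I_#|P|, family i = S.
Proof. by move=> PS; exists (enum_rank_in PS S); apply: enum_rankK_in. Qed.

Lemma family_in (T : finType) (P : {set {set T}}) (i : 'I_#|P|) : family i \in P.
Proof. exact: enum_valP. Qed.

Section Bicovering.
Variables (X : sgraph) (P Q : {set {set X}}).
Hypotheses (tfX : triangle_free X) (PQ : bicovering P Q) (x0 : X).

Definition bicov_graph := gcb_graph 1 1 (@family X P) (@family X Q).

Lemma bicov_SBIC : SBIC (@family X P) (@family X Q).
Proof.
split=> //.
- by move=> i; apply: (bicov_indepP PQ); apply: family_in.
- by move=> i; apply: (bicov_indepQ PQ); apply: family_in.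
- apply/setP => u; rewrite inE; apply/bigcupP.
  by have [S /familyP[i <-] uS] := bicov_coverP PQ u; exists i.
- apply/setP => u; rewrite inE; apply/bigcupP.
  by have [S /familyP[i <-] uS] := bicov_coverQ PQ u; exists i.
- move=> u v; rewrite eleS dist_le2 !negb_or => /and3P[_ uv _].
  by have [[S /familyP[i <-] /andP]|[S /familyP[i <-] /andP]] :=
    bicov_pair PQ uv; [left|right]; exists i.
- move=> u i /dist_set_ge2[ui nui].
  have [T /familyP[j <-] /andP[uj dij]] := bicov_farP PQ (family_in i) ui nui.
  by exists j; split=> //; apply/eqP; rewrite setI_eq0.
move=> u j /dist_set_ge2[uj nuj].
have [S /familyP[i <-] /andP[ui dij]] := bicov_farQ PQ (family_in j) uj nuj.
by exists i; split=> //; apply/eqP; rewrite setI_eq0.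
Qed.

Lemma bicov_GCB : is_GCB 1 1 (@family X P) (@family X Q) bicov_graph.
Proof.
split; first exact: bicov_SBIC.
  exact: gcb_conditions_pos bicov_SBIC _ _ x0.
by exists id => //; exists id.
Qed.

Lemma bicov_chromatic_le (C : finType) (f : X -> C) (fP fQ : {set X} -> C)
    (cK cL : C) :
  proper_coloring f -> cK != cL ->
  {in P, forall S, fP S != cK} -> {in Q, forall S, fQ S != cL} ->
  (forall S x, S \in P -> x \in S -> fP S != f x) ->
  (forall S x, S \in Q -> x \in S -> fQ S != f x) ->
  (forall S T, S \in P -> T \in Q -> [disjoint S & T] -> fP S != fQ T) ->
  chromatic_number bicov_graph <= #|C|.
Proof.
move=> fX cKL fK fL fPX fQX fPQ.
pose g (u : bicov_graph) := match u with
  | VK _ => cK | VL _ => cL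
  | VY i => fP (family i) | VZ j => fQ (family j) | VX x => f x
  end.
apply: (@chromatic_le _ _ g) => u v.
have:= @family_in X P; have:= @family_in X Q => inQ inP.
case: u => [a|a|a|a|a]; case: v => [b|b|b|b|b] //=;
  rewrite ?[cL == _]eq_sym ?[cK == fP _]eq_sym ?[f _ == fP _]eq_sym
    ?[f _ == fQ _]eq_sym ?[fQ _ == fP _]eq_sym ?setI_eq0; auto.
Qed.

End Bicovering.

(** * Disjoint copies *)

Section Copies.
Variables (J : finType) (X : sgraph).

Definition copies_edge (u v : option (J * X)) : bool :=
  match u, v with
  | Some (i, x), Some (j, y) => (i == j) && x -- y
  | _, _ => false
  end.

Lemma copies_edge_sym : symmetric copies_edge.
Proof. by case=> [[i x]|] [[j y]|] //=; rewrite eq_sym sedge_sym. Qed.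

Lemma copies_edge_irrefl : irreflexive copies_edge.
Proof. by case=> [[i x]|] //=; rewrite sedge_irrefl andbF. Qed.

(* The isolated vertex [None] is needed only to make [G] and [X] have the same
   chromatic number. *)
Definition copies := SGraph copies_edge_sym copies_edge_irrefl.

Lemma copies_triangle_free : triangle_free X -> triangle_free copies.
Proof.
move=> tfX [[i x]|] [[j y]|] [[m z]|] //=; rewrite ?andbF //.
apply/negP => /and3P[/andP[_ xy] /andP[_ yz] /andP[_ xz]].
by have := tfX x y z; rewrite xy yz xz.
Qed.

Lemma copies_coloring : 0 < chromatic_number X ->
  exists f : copies -> 'I_(chromatic_number X), proper_coloring f.
Proof.
move=> X_gt0; have [f fX] := chromatic_coloring X.
pose g (u : copies) := if u is Some (_, x) then f x else Ordinal X_gt0.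
by exists g => [[[i x]|] [[j y]|]] //= /andP[_ /fX].
Qed.

Lemma chromatic_copies :
  J -> 0 < chromatic_number X -> chromatic_number copies = chromatic_number X.
Proof.
move=> j0 /copies_coloring[f fX]; apply/eqP; rewrite eqn_leq; apply/andP; split.
  by rewrite -[leqRHS]card_ord; apply: chromatic_le fX.
by apply: (@chromatic_le_hom X copies (fun x => Some (j0, x))) => u v /=; rewrite eqxx.
Qed.

Lemma copies_section_independent (t : J -> X) (S : {set copies}) :
  (forall u, u \in S -> exists j, u = Some (j, t j)) -> independent S.
Proof.
move=> tS u v /tS[i ->] /tS[j ->] /=; apply/negP => /andP[/eqP->].
by rewrite sedge_irrefl.
Qed.

Lemma copies_rainbow (C : finType) (g : copies -> C) (x0 : X) (s : seq J) :
  proper_coloring g -> uniq s -> size s <= chromatic_number X ->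
  exists t : J -> X, uniq [seq g (Some (j, t j)) | j <- s].
Proof.
move=> gP us le_s.
apply: (rainbow_section (h := fun j x => g (Some (j, x))) x0 us) => j.
apply: leq_trans le_s (chromatic_le_codom _) => u v uv.
by apply: gP => /=; rewrite eqxx.
Qed.

End Copies.

Lemma chromatic_gt0_inhabited (X : sgraph) :
  0 < chromatic_number X -> inhabited X.
Proof.
case: (pickP (mem X)) => [x _ _|X0]; first exact: inhabits.
have [f _] := chromatic_coloring X.
suff : chromatic_number X <= 0 by rewrite leqNgt => /negbTE->.
have h (x : X) : void by have := X0 x; rewrite inE.
by rewrite -card_void; apply: (@chromatic_le _ _ h) => u; have := X0 u; rewrite inE.
Qed.

(** * The three pairs of families *)

Definition indep_sets (X : sgraph) : {set {set X}} :=
  [set S : {set X} | [forall u in S, forall v in S, ~~ u -- v]].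

Lemma indep_setsP (X : sgraph) (S : {set X}) :
  reflect (independent S) (S \in indep_sets X).
Proof.
rewrite inE; apply: (iffP forall_inP) => [h u v uS vS|h u uS].
  by have /forall_inP := h u uS; apply.
by apply/forall_inP => v vS; apply: h.
Qed.

Lemma independent1 (X : sgraph) (u : X) : independent [set u].
Proof. by move=> v w; rewrite !inE => /eqP-> /eqP->; rewrite sedge_irrefl. Qed.

Lemma independent2 (X : sgraph) (u v : X) :
  ~~ u -- v -> independent [set u; v].
Proof.
move=> uv w w'; rewrite !inE => /orP[]/eqP-> /orP[]/eqP->;
  by rewrite ?sedge_irrefl // sedge_sym.
Qed.

(** Singletons and non-adjacent pairs serve as all the witnesses. *)
Lemma bicov_all_indep (X : sgraph) : bicovering (indep_sets X) (indep_sets X).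
Proof.
have in1 u : [set u] \in indep_sets X by apply/indep_setsP/independent1.
split.
- by move=> S /indep_setsP.
- by move=> S /indep_setsP.
- by move=> u; exists [set u]; rewrite ?set11.
- by move=> u; exists [set u]; rewrite ?set11.
- move=> u v uv; left; exists [set u; v]; last by rewrite !inE !eqxx orbT.
  exact/indep_setsP/independent2.
- by move=> u S _ uS _; exists [set u]; rewrite ?set11 //= disjoint_sym disjoints1.
by move=> u S _ uS _; exists [set u]; rewrite ?set11 //= disjoints1.
Qed.

Section MissingColor.
Variables (X : sgraph) (C : finType) (f : X -> C).

Definition partial_indep_sets : {set {set X}} :=
  [set S : {set X} in indep_sets X | [exists c, c \notin f @: S]].

(** With two colours available every singleton misses one, so singletons belong to both families;
    pairs are taken from the second. *)
Lemma bicov_partial_indep : 1 < #|C| ->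
  bicovering partial_indep_sets (indep_sets X).
Proof.
move=> C_gt1.
have in1 u : [set u] \in indep_sets X by apply/indep_setsP/independent1.
have in1' u : [set u] \in partial_indep_sets.
  rewrite inE in1; have [c] : exists c, c \in [set~ f u].
    by apply/set0Pn; rewrite -card_gt0 cardsC1 -ltnS prednK // ltnW.
  by rewrite !inE => cu; apply/existsP; exists c; rewrite imset_set1 inE.
split.
- by move=> S; rewrite inE => /andP[/indep_setsP].
- by move=> S /indep_setsP.
- by move=> u; exists [set u]; rewrite ?set11.
- by move=> u; exists [set u]; rewrite ?set11.
- move=> u v uv; right; exists [set u; v]; last by rewrite !inE !eqxx orbT.
  exact/indep_setsP/independent2.
- by move=> u S _ uS _; exists [set u]; rewrite ?set11 //= disjoint_sym disjoints1.
by move=> u S _ uS _; exists [set u]; rewrite ?set11 //= disjoints1.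
Qed.

End MissingColor.

(** * Families anchored at an isolated vertex, for [q = 0] *)

Section AnchoredFamilies.
Variables (X : sgraph) (C : finType) (f : X -> C) (v0 : X) (c1 c2 : C).
Hypotheses (fX : proper_coloring f) (v0_isolated : forall u, ~~ v0 -- u).
Hypotheses (c01 : f v0 != c1) (c02 : f v0 != c2) (c12 : c1 != c2).
Implicit Types (u v : X) (S T : {set X}) (c : C).

Definition dominates_color S c : bool :=
  [forall u, (f u == c) ==> (u \in S) || [exists v in S, u -- v]].

(** A set of [anchoredQ] with a vertex of colour [c1] contains [v0], hence meets every [S]
    containing [v0]. Domination ensures that no vertex of colour [c1] is far from such an [S]. *)
Definition anchoredP : {set {set X}} :=
  [set S : {set X} in indep_sets X | (f v0 \notin f @: S) ||
    [&& v0 \in S, c2 \notin f @: S & dominates_color S c1]].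

(** Dually, a set of [anchoredP] with a vertex of colour [f v0] contains [v0], so the sets
    containing [v0] here must dominate that colour. *)
Definition anchoredQ : {set {set X}} :=
  [set S : {set X} in indep_sets X |
    ((c1 \notin f @: S) || (v0 \in S) && (c2 \notin f @: S)) &&
    ((v0 \in S) ==> dominates_color S (f v0))].

Definition color_hull u c : {set X} :=
  u |: [set v | (f v == c) && ~~ u -- v].

Lemma color_hull_indep u c : independent (color_hull u c).
Proof.
move=> v w; rewrite !inE => /orP[/eqP->|/andP[/eqP fv uv]].
  by case/orP=> [/eqP->|/andP[]] //; rewrite sedge_irrefl.
case/orP=> [/eqP->|/andP[/eqP fw _]]; first by rewrite sedge_sym.
by apply/negP => /fX; rewrite fv fw eqxx.
Qed.

(** A vertex of colour [c] outside the hull is adjacent to [u], which lies in [S]. *)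
Lemma dominates_superset u c S :
  color_hull u c \subset S -> dominates_color S c.
Proof.
move=> /subsetP hS; apply/forallP => v; apply/implyP => fv.
have [uv|uv] := boolP (u -- v); last by rewrite hS // !inE fv uv orbT.
apply/orP; right; apply/exists_inP; exists u; last by rewrite sedge_sym.
by rewrite hS // !inE eqxx.
Qed.

Lemma color_hullP u c c' :
  c' != c -> c' != f u -> c' \notin f @: color_hull u c.
Proof.
move=> cc' cu; apply/imsetP => -[v + def_c'].
rewrite !inE => /orP[/eqP vu|/andP[/eqP fv _]].
  by move: cu; rewrite def_c' vu eqxx.
by move: cc'; rewrite def_c' fv eqxx.
Qed.

Lemma dominated_color S u c : dominates_color S c -> u \notin S ->
  {in S, forall v, ~~ u -- v} -> f u != c.
Proof.
move=> /forallP/(_ u)/implyP domS uS nuS; apply/negP => /domS.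
by rewrite (negPf uS) => /exists_inP[v /nuS/negbTE->].
Qed.

(** The hull shows only the colours [f u] and [f v0]. If [f u = c1] it misses [c2] and contains the
    isolated vertex [v0]; otherwise it misses [c1]. *)
Lemma color_hull_in_Q u : color_hull u (f v0) \in anchoredQ.
Proof.
rewrite inE; apply/andP; split; first exact/indep_setsP/color_hull_indep.
rewrite (dominates_superset (subxx _)) implybT andbT.
have [fu|fu] := eqVneq (f u) c1; last first.
  by rewrite color_hullP // eq_sym.
apply/orP; right; rewrite color_hullP ?fu 1?eq_sym // andbT.
by rewrite !inE eqxx sedge_sym v0_isolated orbT.
Qed.

Lemma anchored_in_P u : f u = f v0 -> v0 |: color_hull u c1 \in anchoredP.
Proof.
move=> fu; rewrite inE; apply/andP; split.
  apply/indep_setsP => v w; rewrite !in_setU1.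
  case/orP=> [/eqP-> _|vS]; first exact: v0_isolated.
  case/orP=> [/eqP->|wS]; first by rewrite sedge_sym.
  by apply: (@color_hull_indep u c1); rewrite in_setU1.
apply/orP; right; rewrite setU11 (dominates_superset (subsetUr _ _)) andbT /=.
rewrite imsetU1 in_setU1 negb_or eq_sym c02 /= color_hullP ?fu // eq_sym //.
Qed.

Lemma bicov_anchored : bicovering anchoredP anchoredQ.
Proof.
have P1 u : f u != f v0 -> [set u] \in anchoredP.
  move=> fu; rewrite inE imset_set1 inE eq_sym fu andbT.
  exact/indep_setsP/independent1.
have Q1 u : f u != c1 -> u != v0 -> [set u] \in anchoredQ.
  move=> fu uv0; rewrite inE imset_set1 !inE eq_sym fu /= eq_sym (negPf uv0) andbT.
  by have /indep_setsP := @independent1 X u; rewrite inE.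
have hull u c : u \in color_hull u c by rewrite setU11.
split.
- by move=> S; rewrite inE => /andP[/indep_setsP].
- by move=> S; rewrite inE => /andP[/indep_setsP].
- move=> u; have [fu|fu] := eqVneq (f u) (f v0).
    by exists (v0 |: color_hull u c1); rewrite ?anchored_in_P // setU1r.
  by exists [set u]; rewrite ?P1 // set11.
- by move=> u; exists (color_hull u (f v0)); rewrite ?color_hull_in_Q.
- move=> u v uv.
  have [fu|fu] := eqVneq (f u) (f v0).
    right; exists (color_hull v (f v0)); first exact: color_hull_in_Q.
    by rewrite hull andbT !inE fu eqxx sedge_sym uv orbT.
  have [fv|fv] := eqVneq (f v) (f v0).
    right; exists (color_hull u (f v0)); first exact: color_hull_in_Q.
    by rewrite hull !inE fv eqxx uv orbT.
  left; exists [set u; v]; last by rewrite !inE !eqxx orbT.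
  rewrite inE; apply/andP; split; first exact/indep_setsP/independent2.
  by rewrite imsetU1 imset_set1 !inE negb_or ![f v0 == _]eq_sym fu fv.
- move=> u S PS uS nuS.
  have [/andP[fu uv0]|] := boolP ((f u != c1) && (u != v0)).
    by exists [set u]; rewrite ?Q1 // set11 disjoint_sym disjoints1.
  (* Here [u] is [v0] or has colour [c1]. If [S] misses [f v0], the hull of [u] avoids it; otherwise
     [S] contains [v0] and dominates [c1], so [u] cannot be far from it. *)
  rewrite negb_and !negbK => fu.
  exists (color_hull u (f v0)); first exact: color_hull_in_Q.
  rewrite hull /=; move: PS; rewrite inE => /andP[_ /orP[f0S|]].
    rewrite disjoint_sym disjoint_subset; apply/subsetP => v.
    rewrite !inE => /orP[/eqP->//|/andP[/eqP fv _]].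
    by apply: contra f0S => vS; rewrite -fv imset_f.
  case/and3P=> v0S _ domS; case/orP: fu => [fu|/eqP uv0].
    by have := dominated_color domS uS nuS; rewrite fu.
  by rewrite uv0 v0S in uS.
move=> u T QT uT nuT.
have [fu|fu] := eqVneq (f u) (f v0); last first.
  by exists [set u]; rewrite ?P1 // set11 disjoints1.
exists (v0 |: color_hull u c1); first exact: anchored_in_P.
rewrite setU1r //=; move: QT; rewrite inE => /and3P[_ fT /implyP domT].
(* Were [v0] in [T], domination would forbid a far vertex [u] of colour [f v0]. So [T] misses [c1],
   the colour of all added vertices except [v0] and [u]. *)
have v0T : v0 \notin T.
  apply/negP => /domT domT'.
  by have := dominated_color domT' uT nuT; rewrite fu eqxx.
rewrite (negPf v0T) /= orbF in fT.
rewrite disjoint_subset; apply/subsetP => v.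
rewrite !inE => /or3P[/eqP->//|/eqP->//|/andP[/eqP fv _]].
by apply: contra fT => vT; rewrite -fv imset_f.
Qed.

Lemma anchored_chromatic_le :
  chromatic_number (bicov_graph anchoredP anchoredQ) <= #|C|.
Proof.
pose gP S := if f v0 \in f @: S then c2 else f v0.
pose gQ S := if c1 \in f @: S then c2 else c1.
have miss c S x : c \notin f @: S -> x \in S -> c != f x.
  by move=> cS xS; apply: contraNneq cS => ->; apply: imset_f.
(* [Y] uses only [f v0] and [c2], leaving [c1] for [K]; [Z] uses only [c1] and [c2], leaving [f v0]
   for [L]. *)
apply: (bicov_chromatic_le (fP := gP) (fQ := gQ) (cK := c1) (cL := f v0) fX).
- by rewrite eq_sym.
- by move=> S _; rewrite /gP; case: ifP; rewrite // eq_sym.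
- by move=> S _; rewrite /gQ; case: ifP; rewrite // eq_sym.
- move=> S x; rewrite inE /gP => /andP[_];
    case: ifP => [_|/negbT f0S _]; last exact: miss.
  by case/and3P=> _ c2S _; apply: miss.
- move=> S x; rewrite inE /gQ => /andP[_ /andP[+ _]].
  case: ifP => [_ /andP[_ c2S]|/negbT c1S _]; exact: miss.
move=> S T; rewrite !inE /gP /gQ => /andP[_ PS] /andP[_ /andP[QT _]].
move: PS QT; case: ifP => [_ /and3P[v0S _ _]|_ _]; case: ifP => //.
  by move=> _ /andP[v0T _] /pred0P/(_ v0) /=; rewrite v0S v0T.
by move=> _ _ _; rewrite eq_sym.
Qed.

End AnchoredFamilies.

(** * Chromatic numbers *)

Section RainbowSets.
Variable X : sgraph.
Let p := chromatic_number X.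
Let Xp := copies (bool * 'I_p)%type X.

(** The boolean splits the copies into two groups of [p], one for [S] and one for [T]. Using one
    vertex per copy makes the union independent. *)
Lemma rainbow_sets (C : finType) (g : Xp -> C) (x0 : X) :
  proper_coloring g ->
  exists S T : {set Xp}, [/\ independent (S :|: T), [disjoint S & T],
    #|g @: S| = p & #|g @: T| = p].
Proof.
move=> gP.
have rb b : exists t : bool * 'I_p -> X, injective (fun j => g (Some ((b, j), t (b, j)))).
  have [||t ut] := copies_rainbow (s := [seq (b, j) | j <- enum 'I_p]) x0 gP.
  - by rewrite map_inj_uniq ?enum_uniq // => i j [].
  - by rewrite size_map size_enum_ord.
  by exists t; apply/injectiveP; rewrite -map_comp in ut.
have [[t1 inj1] [t2 inj2]] := (rb true, rb false).
pose t (bj : bool * 'I_p) := if bj.1 then t1 bj else t2 bj.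
pose R b : {set Xp} := [set Some ((b, j), t (b, j)) | j : 'I_p].
have cardR b : injective (fun j => g (Some ((b, j), t (b, j)))) -> #|g @: R b| = p.
  by move=> injb; rewrite /R -imset_comp card_imset ?card_ord.
exists (R true), (R false); split; [| |exact: cardR|exact: cardR].
  apply: (copies_section_independent (t := t)) => u.
  by rewrite inE => /orP[] /imsetP[j _ ->]; [exists (true, j)|exists (false, j)].
rewrite disjoint_subset; apply/subsetP => _ /imsetP[i _ ->].
by rewrite inE; apply/imsetP => -[].
Qed.

End RainbowSets.

Section LowerBounds.
Variables (X : sgraph) (P Q : {set {set X}}) (C : finType).
Variable g : bicov_graph P Q -> C.
Hypothesis gP : proper_coloring g.
Let gX (x : X) := g (VX x).

Lemma proper_coloringX : proper_coloring gX.
Proof. by move=> u v uv; apply: gP. Qed.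

Lemma gcb_color_P S : S \in P -> 
  exists2 i, family i = S & g (VY i) \notin gX @: S.
Proof.
move=> /familyP[i def_S]; exists i => //; apply/imsetP => -[x xS].
by apply/eqP; apply: gP; rewrite /= def_S.
Qed.

Lemma gcb_color_Q S : S \in Q ->
  exists2 j, family j = S & g (VZ j) \notin gX @: S.
Proof.
move=> /familyP[j def_S]; exists j => //; apply/imsetP => -[x xS].
by apply/eqP; apply: gP; rewrite /= def_S.
Qed.

End LowerBounds.

Lemma independentS (X : sgraph) (S T : {set X}) :
  S \subset T -> independent T -> independent S.
Proof. by move=> /subsetP ST indT u v /ST uT /ST; apply: indT. Qed.

Lemma partial_indep_chromatic (X : sgraph) (p := chromatic_number X)
    (Xp := copies (bool * 'I_p)%type X) (f : Xp -> 'I_p) (x0 : X) :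
  proper_coloring f ->
  chromatic_number (bicov_graph (partial_indep_sets f) (indep_sets Xp)) = p.+1.
Proof.
move=> fX; apply/eqP; rewrite eqn_leq; apply/andP; split.
  pose c0 := f None.
  (* The default [c0] never occurs on the first family, whose members all miss a colour. *)
  pose fP (S : {set Xp}) := Some (odflt c0 [pick c | c \notin f @: S]).
  have <- : #|{: option 'I_p}| = p.+1 by rewrite card_option card_ord.
  have fX' : @proper_coloring Xp _ (fun x => Some (f x)) by move=> u v /fX.
  (* [L] may reuse the old colour [c0]: its neighbours lie in [K] and [Z], all coloured [None]. *)
  apply: (bicov_chromatic_le (fP := fP) (fQ := fun=> None) (cK := None)
    (cL := Some c0) fX') => // S x.
  rewrite inE /fP => /andP[_ /existsP[c cS]] xS.
  case: pickP => [c' c'S /=|/(_ c)]; last by rewrite cS.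
  by apply: contraNneq c'S => -[->]; apply: imset_f.
have [g gP] := chromatic_coloring (bicov_graph (partial_indep_sets f) (indep_sets Xp)).
have [S [T [indST _ cardS _]]] := rainbow_sets x0 (proper_coloringX gP).
have /indep_setsP indS := independentS (subsetUl S T) indST.
have [j _ jS] := gcb_color_Q gP indS.
have <- : #|g (VZ j) |: [set g (VX x) | x in S]| = p.+1.
  by rewrite cardsU1 jS cardS.
by rewrite -[leqRHS]card_ord max_card.
Qed.

Lemma all_indep_chromatic (X : sgraph) (p := chromatic_number X)
    (Xp := copies (bool * 'I_p)%type X) (x0 : X) :
  chromatic_number Xp = p ->
  chromatic_number (bicov_graph (indep_sets Xp) (indep_sets Xp)) = p.+2.
Proof.
move=> chiXp; apply/eqP; rewrite eqn_leq; apply/andP; split.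
  have [f fX] := chromatic_coloring Xp.
  have <- : #|{: option (option 'I_(chromatic_number Xp))}| = p.+2.
    by rewrite !card_option card_ord chiXp.
  have fX' : @proper_coloring Xp _ (fun x => Some (Some (f x))).
    by move=> u v /fX.
  (* One new colour serves [Y] and [L], the other [Z] and [K]. *)
  exact: (bicov_chromatic_le (fP := fun=> None) (fQ := fun=> Some None)
    (cK := Some None) (cL := None) fX').
set G := bicov_graph _ _.
have [g gP] := chromatic_coloring G; rewrite leqNgt; apply/negP => chiG.
have [S [T [indST dST cardS cardT]]] := rainbow_sets x0 (proper_coloringX gP).
have /indep_setsP indS := independentS (subsetUl S T) indST.
have /indep_setsP indT := independentS (subsetUr S T) indST.
move/indep_setsP: indST => indST.
have [i def_i iS] := gcb_color_P gP indS.
have [j def_j jT] := gcb_color_Q gP indT.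
have [m _] := gcb_color_P gP indST.
rewrite imsetU in_setU negb_or => /andP[mS mT].
(* [p] colours on a rainbow set leave at most one colour. *)
have last_color (R : {set 'I_(chromatic_number G)}) a b :
    #|R| = p -> a \notin R -> b \notin R -> a = b.
  move=> cardR aR bR; apply/eqP; apply: contraLR chiG => ab.
  rewrite -leqNgt -cardR -[leqRHS]card_ord.
  have <- : #|a |: (b |: R)| = #|R|.+2.
    by rewrite !cardsU1 !inE negb_or ab aR bR.
  exact: max_card.
have /gP/eqP[] : sedge (VY i : G) (VZ j) by rewrite /= def_i def_j setI_eq0.
by rewrite -(last_color _ _ _ cardS mS iS) (last_color _ _ _ cardT mT jT).
Qed.

(** * Realization of the required graphs *)

Lemma bicov_realization (X : sgraph) (P Q : {set {set X}}) (x0 : X) :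
  triangle_free X -> bicovering P Q ->
  [/\ is_GCB 1 1 (@family X P) (@family X Q) (bicov_graph P Q),
      triangle_free (bicov_graph P Q) & two_self_centered (bicov_graph P Q)].
Proof.
move=> tfX PQ; have AB := bicov_SBIC tfX PQ; split.
- exact: bicov_GCB.
- exact: gcb_triangle_free.
exact: gcb_two_self_centered.
Qed.

(** The induction starts at the complete graph on [bool] because [bicov_partial_indep] needs two
    colours. *)
Lemma triangle_free_chromatic p : 2 <= p ->
  exists2 X : sgraph, triangle_free X & chromatic_number X = p.
Proof.
case: p => [|[|p]] // _; elim: p => [|p [X tfX chiX]].
  have symK : symmetric (fun a b : bool => a != b) by move=> a b; rewrite eq_sym.
  have irrK : irreflexive (fun a b : bool => a != b) by move=> a; rewrite eqxx.
  exists (SGraph symK irrK); first by case=> [] [] [].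
  apply/eqP; rewrite eqn_leq -{1}card_bool; apply/andP; split.
    exact: (@chromatic_le (SGraph symK irrK) bool id).
  have [f fP] := chromatic_coloring (SGraph symK irrK).
  have:= fP true false isT; move: f {fP}; case: chromatic_number => [|[|]] // f.
    by case: (f true).
  by rewrite [f true]ord1 [f false]ord1.
have chi_gt0 : 0 < chromatic_number X by rewrite chiX.
have [x0] := chromatic_gt0_inhabited chi_gt0.
have [f fX] := copies_coloring (bool * 'I_(chromatic_number X))%type chi_gt0.
exists (bicov_graph (partial_indep_sets f) (indep_sets _)).
  have [] // := bicov_realization (None : copies _ X) _ (bicov_partial_indep f _).
  - exact: copies_triangle_free.
  - by rewrite card_ord chiX.
by rewrite partial_indep_chromatic // chiX.
Qed.

Theorem theorem4 (p q : nat) (hp : 2 <= p) (hq : q \in [:: 0; 1; 2])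
    (hpq : (p, q) <> (2, 0)) :
  exists (G X : sgraph) (k l r s : nat)
         (A : 'I_r -> {set X}) (B : 'I_s -> {set X}),
    [/\ is_GCB k l A B G,
        triangle_free G,
        two_self_centered G,
        chromatic_number X = p
      & chromatic_number G = chromatic_number X + q].
Proof.
have [X tfX chiX] := triangle_free_chromatic hp.
have chi_gt0 : 0 < chromatic_number X by rewrite chiX ltnW.
have [x0] := chromatic_gt0_inhabited chi_gt0.
(* The witness for the graph [X] of the statement is [Xp], which has the same chromatic number and
   the isolated vertex [None]. *)
pose Xp := copies (bool * 'I_(chromatic_number X))%type X.
have chiXp : chromatic_number Xp = chromatic_number X.
  by apply: chromatic_copies => //; exact: (true, Ordinal chi_gt0).
have tfXp : triangle_free Xp by exact: copies_triangle_free.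
have [f fX] : exists f : Xp -> _, proper_coloring f := copies_coloring _ chi_gt0.
suff [P [Q [PQ chiG]]] : exists P Q : {set {set Xp}},
    bicovering P Q /\ chromatic_number (bicov_graph P Q) = p + q.
  have [GCB tfG scG] := bicov_realization (None : Xp) tfXp PQ.
  by do 8 eexists; split; [exact: GCB | | | rewrite chiXp | rewrite chiXp chiX].
move: hq hpq; rewrite !inE => /or3P[] /eqP-> hpq.
(* Excluding [(2, 0)] leaves at least three colours here, hence two besides that of [None]. *)
- have p_gt2 : 2 < p by case: p hp hpq {chiX} => [|[|[|]]].
  have : 1 < #|[set~ f None]| by rewrite cardsC1 card_ord chiX;
    case: p p_gt2 {hp hpq chiX} => [|[|[|]]].
  case/card_gt1P => c1 [c2 []]; rewrite !inE => c01 c02 c12.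
  rewrite eq_sym in c01; rewrite eq_sym in c02.
  exists (anchoredP f None c1 c2), (anchoredQ f None c1 c2).
  split; first exact: bicov_anchored.
  apply/eqP; rewrite addn0 eqn_leq -chiX; apply/andP; split.
    by rewrite -[leqRHS]card_ord anchored_chromatic_le.
  by rewrite -[leqLHS]chiXp;
    apply: (@chromatic_le_hom Xp (bicov_graph _ _) (@VX _ _ _ _ _)).
- exists (partial_indep_sets f), (indep_sets Xp); split.
    by apply: bicov_partial_indep; rewrite card_ord chiX.
  by rewrite partial_indep_chromatic // chiX addn1.
exists (indep_sets Xp), (indep_sets Xp); split; first exact: bicov_all_indep.
by rewrite all_indep_chromatic // chiX addn2.
Qed.
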